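(* (The $3\to2$ move of the bias $1/10$ game.) Let $\Gamma_1,\Gamma_2,y_0'$ be real numbers with $0<y_0'<\min(\Gamma_1,\Gamma_2)$, let $f(y)=(y_0'-y)(\Gamma_1-y)(\Gamma_2-y)$, and let $y\in(y_0',\min(\Gamma_1,\Gamma_2))$. For $\delta>0$ write $y_{(m)}=y+m\delta$ and set $$x_{g_1}=0,\quad x_{g_2}=y_{(-2)},\quad x_{g_3}=y_{(1)},\quad x_{h_1}=y_{(-1)},\quad x_{h_2}=y_{(2)},$$ $$p_{g_1}=\frac{f(0)\,\delta}{y_{(2)}y_{(1)}y_{(-1)}y_{(-2)}},\quad p_{g_2}=\frac{-f(y_{(-2)})}{12\,\delta^2y_{(-2)}},\quad p_{g_3}=\frac{-f(y_{(1)})}{6\,\delta^2y_{(1)}},\quad p_{h_1}=\frac{-f(y_{(-1)})}{6\,\delta^2y_{(-1)}},\quad p_{h_2}=\frac{-f(y_{(2)})}{12\,\delta^2y_{(2)}}.$$ Let $|g_1\rangle,|g_2\rangle,|g_3\rangle,|h_1\rangle,|h_2\rangle$ be orthonormal and define the normalised vectors $$|v\rangle=\frac{\sum_{i=1}^3\sqrt{p_{g_i}}|g_i\rangle}{N_g},\quad |v_1\rangle=\frac{\sqrt{p_{g_3}}|g_2\rangle-\sqrt{p_{g_2}}|g_3\rangle}{N_{v_1}},\quad |v_2\rangle=\frac{-\frac{p_{g_2}+p_{g_3}}{\sqrt{p_{g_1}}}|g_1\rangle+\sqrt{p_{g_2}}|g_2\rangle+\sqrt{p_{g_3}}|g_3\rangle}{N_{v_2}},$$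 $$|w\rangle=\frac{\sqrt{p_{h_1}}|h_1\rangle+\sqrt{p_{h_2}}|h_2\rangle}{N_h},\quad |w_1\rangle=\frac{\sqrt{p_{h_2}}|h_1\rangle-\sqrt{p_{h_1}}|h_2\rangle}{N_h}$$ (with positive normalisation constants $N_g,N_{v_1},N_{v_2},N_h$), and $\langle x_g\rangle=\frac1{N_g^2}\sum_ip_{g_i}x_{g_i}$. Then for all sufficiently small $\delta>0$ the equation $$\frac{\sqrt{p_{h_1}p_{h_2}}}{N_h^2}(x_{h_1}-x_{h_2})-\cos\theta\,\frac{\sqrt{p_{g_2}p_{g_3}}}{N_gN_{v_1}}(x_{g_2}-x_{g_3})-\sin\theta\,\langle x_g\rangle\frac{N_g}{N_{v_2}}=0$$ has a real solution $\theta$, and, for the solution with $\cos\theta$ closest to $1$, with $|v_1'\rangle=\cos\theta|v_1\rangle+\sin\theta|v_2\rangle$ and $|v_2'\rangle=\sin\theta|v_1\rangle-\cos\theta|v_2\rangle$, the unitary $$U=|w\rangle\langle v|+|w_1\rangle\langle v_1'|+|v_2'\rangle\langle v_2'|+|v_1'\rangle\langle w_1|+|v\rangle\langle w|$$ satisfies $U|v\rangle=|w\rangle$ and $$\sum_{i=1}^2x_{h_i}|h_i\rangle\langle h_i|-\sum_{i=1}^3x_{g_i}E_hU|g_i\rangle\langle g_i|U^\dagger E_h\ge0,\qquad E_h=|h_1\rangle\langle h_1|+|h_2\rangle\langle h_2|.$$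
   Context: Matrix inequalities are in the positive semidefinite order. All vectors live in the 5-dimensional space spanned by $|g_1\rangle,|g_2\rangle,|g_3\rangle,|h_1\rangle,|h_2\rangle$. For sufficiently small $\delta$ all the weights $p_{g_i},p_{h_i}$ are positive. *)

(* Defs.v *)
From HB Require Import structures.
From mathcomp Require Import all_boot all_order all_algebra.
From mathcomp Require Import all_classical all_reals all_analysis.
From mathcomp Require Import sesquilinear spectral complex.
Set Implicit Arguments.
Unset Strict Implicit.
Unset Printing Implicit Defensive.
Import Order.TTheory GRing.Theory Num.Theory.
Import numFieldNormedType.Exports.
Local Open Scope ring_scope.
Local Open Scope complex_scope.
Local Open Scope sesquilinear_scope.

Section Kets.
Context {R : realType} {n : nat}.

(* Kets are column vectors; [M ^t*] is the conjugate transpose. *)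
Definition braket (u v : 'cV[R[i]]_n) : R[i] := (u ^t* *m v) 0 0.

Definition ketbra (u v : 'cV[R[i]]_n) : 'M[R[i]]_n := u *m v ^t*.

Definition ketnorm (u : 'cV[R[i]]_n) : R := Num.sqrt (complex.Re (braket u u)).

(* The order on [R[i]] makes [0 <= z] mean that z is real and nonnegative. *)
Definition psdmx (A : 'M[R[i]]_n) : Prop :=
  A \is hermsymmx /\ forall u : 'cV[R[i]]_n, 0 <= (u ^t* *m A *m u) 0 0.

Definition orthonormal_kets (k l : nat)
    (g : 'I_k -> 'cV[R[i]]_n) (h : 'I_l -> 'cV[R[i]]_n) : Prop :=
  [/\ forall i j, braket (g i) (g j) = (i == j)%:R,
      forall i j, braket (h i) (h j) = (i == j)%:R
    & forall i j, braket (g i) (h j) = 0].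

End Kets.

(* A move from three points to two points of the line. All indices start at 0:
   [xg m 0], [xg m 1], [xg m 2] are x_{g_1}, x_{g_2}, x_{g_3}, and so on. *)
Record move32 (R : Type) := Move32 {
  xg : 'I_3 -> R;
  pg : 'I_3 -> R;
  xh : 'I_2 -> R;
  ph : 'I_2 -> R
}.

Section BiasMove.
Context {R : realType}.

Definition fpoly (G1 G2 y0 t : R) : R := (y0 - t) * (G1 - t) * (G2 - t).

Definition bias_move (G1 G2 y0 y d : R) : move32 R :=
  let f := fpoly G1 G2 y0 in
  let ys (m : int) : R := y + m%:~R * d in
  Move32
    (fun i => [:: 0; ys (-2); ys 1]`_i)
    (fun i => [:: f 0 * d / (ys 2 * ys 1 * ys (-1) * ys (-2));
                  - f (ys (-2)) / (12 * d ^+ 2 * ys (-2));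
                  - f (ys 1) / (6 * d ^+ 2 * ys 1)]`_i)
    (fun i => [:: ys (-1); ys 2]`_i)
    (fun i => [:: - f (ys (-1)) / (6 * d ^+ 2 * ys (-1));
                  - f (ys 2) / (12 * d ^+ 2 * ys 2)]`_i).

End BiasMove.

Section Unitary.
Context {R : realType}.
Variables (m : move32 R) (g : 'I_3 -> 'cV[R[i]]_5) (h : 'I_2 -> 'cV[R[i]]_5).

Let sg (i : 'I_3) : R := Num.sqrt (pg m i).
Let sh (i : 'I_2) : R := Num.sqrt (ph m i).

(* The vectors before normalisation. *)
Definition v_raw : 'cV[R[i]]_5 := \sum_i (sg i)%:C *: g i.
Definition v1_raw : 'cV[R[i]]_5 := (sg 2)%:C *: g 1 - (sg 1)%:C *: g 2.
Definition v2_raw : 'cV[R[i]]_5 :=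
  (- ((pg m 1 + pg m 2) / sg 0))%:C *: g 0
    + (sg 1)%:C *: g 1 + (sg 2)%:C *: g 2.
Definition w_raw : 'cV[R[i]]_5 := \sum_i (sh i)%:C *: h i.
Definition w1_raw : 'cV[R[i]]_5 := (sh 1)%:C *: h 0 - (sh 0)%:C *: h 1.

Definition Ng : R := ketnorm v_raw.
Definition Nv1 : R := ketnorm v1_raw.
Definition Nv2 : R := ketnorm v2_raw.
Definition Nh : R := ketnorm w_raw.

Definition vket : 'cV[R[i]]_5 := (Ng^-1)%:C *: v_raw.
Definition v1ket : 'cV[R[i]]_5 := (Nv1^-1)%:C *: v1_raw.
Definition v2ket : 'cV[R[i]]_5 := (Nv2^-1)%:C *: v2_raw.
Definition wket : 'cV[R[i]]_5 := (Nh^-1)%:C *: w_raw.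
Definition w1ket : 'cV[R[i]]_5 := (Nh^-1)%:C *: w1_raw.

Definition mean_xg : R := (Ng ^+ 2)^-1 * \sum_i pg m i * xg m i.

Definition angle_eq (t : R) : Prop :=
  Num.sqrt (ph m 0 * ph m 1) / Nh ^+ 2 * (xh m 0 - xh m 1)
  - cos t * (Num.sqrt (pg m 1 * pg m 2) / (Ng * Nv1)) * (xg m 1 - xg m 2)
  - sin t * mean_xg * (Ng / Nv2) = 0.

Definition closest_angle (t : R) : Prop :=
  angle_eq t /\ forall t' : R, angle_eq t' -> `|cos t - 1| <= `|cos t' - 1|.

Definition v1ket' (t : R) : 'cV[R[i]]_5 :=
  (cos t)%:C *: v1ket + (sin t)%:C *: v2ket.
Definition v2ket' (t : R) : 'cV[R[i]]_5 :=
  (sin t)%:C *: v1ket - (cos t)%:C *: v2ket.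

Definition Umx (t : R) : 'M[R[i]]_5 :=
  ketbra wket vket + ketbra w1ket (v1ket' t) + ketbra (v2ket' t) (v2ket' t)
  + ketbra (v1ket' t) w1ket + ketbra vket wket.

Definition Eh : 'M[R[i]]_5 := ketbra (h 0) (h 0) + ketbra (h 1) (h 1).

End Unitary.

(* Main.v *)
Require Import Defs.
From HB Require Import structures.
From mathcomp Require Import all_boot all_order all_algebra.
From mathcomp Require Import all_classical all_reals all_analysis.
From mathcomp Require Import sesquilinear spectral complex.
From mathcomp Require Import ring lra.
Import Order.TTheory GRing.Theory Num.Theory.
Import numFieldNormedType.Exports.
Local Open Scope classical_set_scope.
Local Open Scope ring_scope.
Local Open Scope complex_scope.
Local Open Scope sesquilinear_scope.

(** The unitary swaps the orthonormal pairs (v, w) and (v1', w1) and fixes v2',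
    so E_h U |g_i> = <v|g_i> w + <v1'|g_i> w1 and the matrix of the theorem lives
    on span(w, w1).  In the basis (w, w1) its off-diagonal entry is the left-hand
    side of the angle equation, hence vanishes; its first diagonal entry is
    <x_h> - <x_g> = d / N^2.  Rotating v1 towards v2 changes the mean of X_g by a
    nonpositive term and a cross term O(d^(5/2)), so the second diagonal entry is
    at least <w1|X_h|w1> - <v1|X_g|v1> - O(d^(5/2)) = 2 d + O(d^2).

    The angle equation a = b cos t + c sin t is solvable iff a^2 <= b^2 + c^2.
    Both a^2 - b^2 and c^2 are of order d^3; with F(t) = - f(t) / t, the leading
    terms reduce the condition to F'(y) < f(0) / y^2, i.e. to
    2 y < y0 + G1 + G2. *)

(** * Kets and real combinations of kets *)

Section KetTheory.
Local Notation conjC := Num.conj_op.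
Local Set Implicit Arguments.
Local Unset Strict Implicit.
Context {R : realType} {n : nat}.
Implicit Types (u v w : 'cV[R[i]]_n) (A B : 'M[R[i]]_n).

Lemma adjmxD p q (A B : 'M[R[i]]_(p, q)) : (A + B) ^t* = A ^t* + B ^t*.
Proof. by rewrite linearD map_mxD. Qed.

Lemma adjmx_sum p q (I : Type) (r : seq I) (F : I -> 'M[R[i]]_(p, q)) :
  (\sum_(i <- r) F i) ^t* = \sum_(i <- r) (F i) ^t*.
Proof. by rewrite linear_sum (raddf_sum (map_mx conjC)). Qed.

Lemma conjC_real (x : R) : conjC x%:C = x%:C.
Proof. by rewrite conj_Creal ?complex_real. Qed.

Lemma adjmxZ p q (x : R) (A : 'M[R[i]]_(p, q)) : (x%:C *: A) ^t* = x%:C *: A ^t*.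
Proof. by apply/matrixP => i j; rewrite !mxE rmorphM /= conjC_real. Qed.

Lemma adjmxM p q r (A : 'M[R[i]]_(p, q)) (B : 'M[R[i]]_(q, r)) :
  (A *m B) ^t* = B ^t* *m A ^t*.
Proof. by rewrite trmx_mul map_mxM. Qed.

Lemma adjmxK p q (A : 'M[R[i]]_(p, q)) : A ^t* ^t* = A.
Proof. by rewrite map_trmx trmxK map_mxCK. Qed.

Lemma braketC u v : braket u v = conjC (braket v u).
Proof. by rewrite /braket -[in LHS](adjmxK v) -adjmxM mxE mxE. Qed.

Lemma braketZl (x : R) u v : braket (x%:C *: u) v = x%:C * braket u v.
Proof. by rewrite /braket adjmxZ -scalemxAl mxE. Qed.

Lemma braketZr (x : R[i]) u v : braket u (x *: v) = x * braket u v.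
Proof. by rewrite /braket -scalemxAr mxE. Qed.

Lemma braket_suml (I : Type) (r : seq I) (F : I -> 'cV[R[i]]_n) u :
  braket (\sum_(i <- r) F i) u = \sum_(i <- r) braket (F i) u.
Proof. by rewrite /braket adjmx_sum mulmx_suml summxE. Qed.

Lemma braket_sumr (I : Type) (r : seq I) (F : I -> 'cV[R[i]]_n) u :
  braket u (\sum_(i <- r) F i) = \sum_(i <- r) braket u (F i).
Proof. by rewrite /braket mulmx_sumr summxE. Qed.

Lemma ketbra_adj u v : (ketbra u v) ^t* = ketbra v u.
Proof. by rewrite /ketbra adjmxM adjmxK. Qed.

Lemma ketbra_ket u v w : ketbra u v *m w = braket v w *: u.
Proof.
by rewrite /ketbra /braket -mulmxA [v ^t* *m w in LHS]mx11_scalar mul_mx_scalar.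
Qed.

Lemma ketbraM u v u' v' : ketbra u v *m ketbra u' v' = braket v u' *: ketbra u v'.
Proof. by rewrite {2}/ketbra mulmxA ketbra_ket -scalemxAl. Qed.

Lemma mulmx_ketbra A u v : A *m ketbra u v *m A ^t* = ketbra (A *m u) (A *m v).
Proof. by rewrite /ketbra adjmxM !mulmxA. Qed.

Lemma ketbraDl u v w : ketbra (u + v) w = ketbra u w + ketbra v w.
Proof. by rewrite /ketbra mulmxDl. Qed.

Lemma ketbraDr u v w : ketbra u (v + w) = ketbra u v + ketbra u w.
Proof. by rewrite /ketbra adjmxD mulmxDr. Qed.

Lemma ketbraZl (x : R) u v : ketbra (x%:C *: u) v = x%:C *: ketbra u v.
Proof. by rewrite /ketbra -scalemxAl. Qed.

Lemma ketbraZr (x : R) u v : ketbra u (x%:C *: v) = x%:C *: ketbra u v.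
Proof. by rewrite /ketbra adjmxZ scalemxAr. Qed.

Definition orthonormal_family k (e : 'I_k -> 'cV[R[i]]_n) :=
  forall i j, braket (e i) (e j) = (i == j)%:R.

(** Orthonormality of [e] collapses the product with the adjoint to the sum of the projectors on the
    [f i]. There are as many vectors as dimensions, so these projectors sum to the identity. *)
Lemma unitarymx_sum_ketbra (e f : 'I_n -> 'cV[R[i]]_n) :
  orthonormal_family e -> orthonormal_family f ->
  \sum_i ketbra (f i) (e i) \is unitarymx.
Proof.
move=> eo fo; apply/unitarymxP.
have -> : (\sum_i ketbra (f i) (e i)) *m (\sum_i ketbra (f i) (e i)) ^t* =
    \sum_i ketbra (f i) (f i).
  rewrite adjmx_sum mulmx_suml; apply: eq_bigr => i _.
  rewrite mulmx_sumr (bigD1 i) //= big1 => [|j /negPf ji].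
    by rewrite addr0 ketbra_adj ketbraM eo eqxx scale1r.
  by rewrite ketbra_adj ketbraM eo eq_sym ji scale0r.
(* The columns of [M] are the [f i]. Orthonormality is [M ^t* *m M = 1%:M], and for a square matrix
   the factors may be exchanged, which is completeness. *)
pose M : 'M[R[i]]_n := \matrix_(i, j) f j i 0.
have MM : M ^t* *m M = 1%:M.
  apply/matrixP => i j; rewrite mxE [RHS]mxE -fo /braket mxE.
  by apply: eq_bigr => k _; rewrite !mxE.
rewrite -(mulmx1C MM); apply/matrixP => i j; rewrite summxE mxE.
by apply: eq_bigr => k _; rewrite !mxE big_ord1 !mxE.
Qed.

Lemma psdmxD A B : psdmx A -> psdmx B -> psdmx (A + B).
Proof.
move=> [/is_hermitianmxP hA pA] [/is_hermitianmxP hB pB]; split.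
  apply/is_hermitianmxP; move: hA hB; rewrite !expr0 !scale1r adjmxD.
  by move=> <- <-.
by move=> u; rewrite mulmxDr mulmxDl mxE addr_ge0.
Qed.

Lemma psdmx_ketbra (x : R) u : 0 <= x -> psdmx (x%:C *: ketbra u u).
Proof.
move=> x0; split.
  by apply/is_hermitianmxP; rewrite expr0 scale1r adjmxZ ketbra_adj.
move=> v; rewrite -mulmxA -scalemxAl ketbra_ket -!scalemxAr 2!mxE.
rewrite -/(braket v u) (braketC v u) mulr_ge0 ?ler0c //.
by rewrite -normCK exprn_ge0.
Qed.

(** All vectors of the move have real coordinates, so their brackets reduce to real dot products. *)
Definition rcomb k (e : 'I_k -> 'cV[R[i]]_n) (a : 'I_k -> R) :=
  \sum_i (a i)%:C *: e i.

Lemma rcombD k (e : 'I_k -> 'cV[R[i]]_n) a b :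
  rcomb e a + rcomb e b = rcomb e (fun i => a i + b i).
Proof.
by rewrite -big_split; apply: eq_bigr => i _; rewrite rmorphD scalerDl.
Qed.

Lemma rcombZ k (e : 'I_k -> 'cV[R[i]]_n) x a :
  x%:C *: rcomb e a = rcomb e (fun i => x * a i).
Proof.
by rewrite scaler_sumr; apply: eq_bigr => i _; rewrite rmorphM scalerA.
Qed.

Lemma braket_rcombl k (e : 'I_k -> 'cV[R[i]]_n) a j :
  orthonormal_family e -> braket (rcomb e a) (e j) = (a j)%:C.
Proof.
move=> eo; rewrite braket_suml (bigD1 j) //= big1 => [|i /negPf ij].
  by rewrite braketZl eo eqxx mulr1 addr0.
by rewrite braketZl eo ij mulr0.
Qed.

Lemma braket_rcomb k (e : 'I_k -> 'cV[R[i]]_n) a b :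
  orthonormal_family e -> braket (rcomb e a) (rcomb e b) = (\sum_i a i * b i)%:C.
Proof.
move=> eo; rewrite braket_sumr rmorph_sum; apply: eq_bigr => j _.
by rewrite braketZr braket_rcombl // rmorphM mulrC.
Qed.

Lemma braket_rcomb0 k l (e : 'I_k -> 'cV[R[i]]_n) (f : 'I_l -> 'cV[R[i]]_n) a b :
  (forall i j, braket (e i) (f j) = 0) -> braket (rcomb e a) (rcomb f b) = 0.
Proof.
move=> ef; rewrite braket_sumr big1 // => j _.
rewrite braketZr braket_suml big1 ?mulr0 // => i _.
by rewrite braketZl ef mulr0.
Qed.

Lemma ketnorm_rcomb k (e : 'I_k -> 'cV[R[i]]_n) a :
  orthonormal_family e -> ketnorm (rcomb e a) = Num.sqrt (\sum_i a i ^+ 2).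
Proof.
by move=> eo; rewrite /ketnorm braket_rcomb.
Qed.

(** Real coefficients give both cross terms the same factor. This yields the 2 by 2 matrix of a
    diagonal observable compressed to the span of [u] and [v]. *)
Lemma sum_ketbra_pair k (x a b : 'I_k -> R) u v :
  \sum_i (x i)%:C *: ketbra ((a i)%:C *: u + (b i)%:C *: v)
                            ((a i)%:C *: u + (b i)%:C *: v) =
  (\sum_i x i * a i ^+ 2)%:C *: ketbra u u
  + (\sum_i x i * (a i * b i))%:C *: (ketbra u v + ketbra v u)
  + (\sum_i x i * b i ^+ 2)%:C *: ketbra v v.
Proof.
have expand (K : comNzRingType) (V : lmodType K) (p q r : K) (A B C D : V) :
    p *: (q *: (q *: A) + q *: (r *: B) + (r *: (q *: C) + r *: (r *: D))) =
    (p * q ^+ 2) *: A + (p * (q * r)) *: (B + C) + (p * r ^+ 2) *: D.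
  rewrite !scalerDr !scalerA -!addrA.
  by congr (_ *: _ + (_ *: _ + (_ *: _ + _ *: _))); ring.
rewrite !rmorph_sum !scaler_suml -!big_split; apply: eq_bigr => i _ /=.
rewrite ketbraDl 2!ketbraDr 4!ketbraZl 4!ketbraZr expand.
by rewrite -!rmorphXn -!rmorphM.
Qed.

End KetTheory.

(** * The swap unitary *)

Section SwapUnitary.
Local Set Implicit Arguments.
Local Unset Strict Implicit.
Context {R : realType}.

Lemma orthonormal_family5 n (a b c d e : 'cV[R[i]]_n) :
  [/\ braket a a = 1, braket b b = 1, braket c c = 1, braket d d = 1
    & braket e e = 1] ->
  [/\ braket a b = 0, braket a c = 0, braket a d = 0 & braket a e = 0] ->
  [/\ braket b c = 0, braket b d = 0 & braket b e = 0] ->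
  [/\ braket c d = 0, braket c e = 0 & braket d e = 0] ->
  orthonormal_family (fun i : 'I_5 => [:: a; b; c; d; e]`_i).
Proof.
move=> [aa bb cc dd ee] [ab ac ad ae] [bc bd be] [cd ce de].
have sym (u v : 'cV[R[i]]_n) : braket u v = 0 -> braket v u = 0.
  by move=> uv; rewrite braketC uv rmorph0.
have facts := (aa, bb, cc, dd, ee,
  ab, ac, ad, ae, bc, bd, be, cd, ce, de,
  (sym _ _ ab, sym _ _ ac, sym _ _ ad, sym _ _ ae, sym _ _ bc, sym _ _ bd,
   sym _ _ be, sym _ _ cd, sym _ _ ce, sym _ _ de)).
by move=> [[|[|[|[|[|?]]]]] ?] [[|[|[|[|[|?]]]]] ?]; rewrite -val_eqE /= ?facts.
Qed.

Definition dotr k (a b : 'I_k -> R) : R := \sum_i a i * b i.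

Section Blocks.
Variables (g : 'I_3 -> 'cV[R[i]]_5) (h : 'I_2 -> 'cV[R[i]]_5).
Variables (a a1 a2 : 'I_3 -> R) (b b1 : 'I_2 -> R).
Hypotheses (gh : orthonormal_kets g h).
Hypotheses (an : [/\ dotr a a = 1, dotr a1 a1 = 1 & dotr a2 a2 = 1]).
Hypotheses (ao : [/\ dotr a a1 = 0, dotr a a2 = 0 & dotr a1 a2 = 0]).
Hypotheses (bn : dotr b b = 1 /\ dotr b1 b1 = 1) (bo : dotr b b1 = 0).

Let v := rcomb g a.
Let v1 := rcomb g a1.
Let v2 := rcomb g a2.
Let w := rcomb h b.
Let w1 := rcomb h b1.
Let U := ketbra w v + ketbra w1 v1 + ketbra v2 v2 + ketbra v1 w1 + ketbra v w.

Let rcombg x y : braket (rcomb g x) (rcomb g y) = (dotr x y)%:C.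
Proof. by case: gh => gg _ _; rewrite braket_rcomb. Qed.

Let rcombh x y : braket (rcomb h x) (rcomb h y) = (dotr x y)%:C.
Proof. by case: gh => _ hh _; rewrite braket_rcomb. Qed.

Let rcombgh x y : braket (rcomb g x) (rcomb h y) = 0.
Proof. by case: gh => _ _ ?; rewrite braket_rcomb0. Qed.

Let rcombhg x y : braket (rcomb h x) (rcomb g y) = 0.
Proof. by rewrite braketC rcombgh rmorph0. Qed.

(** [U] maps the orthonormal basis (v, v1, v2, w1, w) to the same basis listed as (w, w1, v2, v1,
    v). *)
Lemma swap_unitarymx : U \is unitarymx.
Proof.
case: an ao bn => [aa a11 a22] [a01 a02 a12] [bb b11].
have -> : U = \sum_(i < 5) ketbra ([:: w; w1; v2; v1; v]`_i)
                                   ([:: v; v1; v2; w1; w]`_i).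
  by rewrite !big_ord_recl big_ord0 /= addr0 !addrA.
have dotC k (x y : 'I_k -> R) : dotr x y = dotr y x.
  by apply: eq_bigr => i _; rewrite mulrC.
by apply: unitarymx_sum_ketbra; apply: orthonormal_family5; split;
  rewrite ?rcombgh ?rcombhg ?rcombg ?rcombh ?aa ?a11 ?a22 ?a01 ?a02 ?a12 ?bb ?b11 ?bo
    ?(dotC _ a1 a) ?(dotC _ a2 a) ?(dotC _ a2 a1) ?(dotC _ b1 b)
    ?a01 ?a02 ?a12 ?bo.
Qed.

Lemma swap_ket : U *m v = w.
Proof.
case: an ao => [aa _ _] [a01 a02 _].
have dotC k (x y : 'I_k -> R) : dotr x y = dotr y x.
  by apply: eq_bigr => i _; rewrite mulrC.
rewrite !mulmxDl !ketbra_ket !rcombg !rcombhg aa (dotC _ a1) (dotC _ a2) a01 a02.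
by rewrite rmorph0 !scale0r !addr0 rmorph1 scale1r.
Qed.

Lemma Eh_rcombh x : Eh h *m rcomb h x = rcomb h x.
Proof.
case: gh => _ hh _.
have bh i : braket (h i) (rcomb h x) = (x i)%:C.
  by rewrite braketC braket_rcombl // conjC_real.
rewrite /Eh mulmxDl !ketbra_ket !bh /rcomb !big_ord_recl big_ord0 addr0.
by congr (_ + (x _)%:C *: h _); apply/val_inj.
Qed.

Lemma Eh_rcombg x : Eh h *m rcomb g x = 0.
Proof.
case: gh => _ _ ghn.
have bh i : braket (h i) (rcomb g x) = 0.
  rewrite braketC braket_suml big1 ?rmorph0 // => j _.
  by rewrite braketZl ghn mulr0.
by rewrite /Eh mulmxDl !ketbra_ket !bh !scale0r addr0.
Qed.

(** On [g i] the terms ending in the bras of [w] and [w1] vanish, and the surviving [v2] component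
    lies in the span of [g], which [Eh] kills. *)
Lemma swap_block i : Eh h *m U *m g i = (a i)%:C *: w + (a1 i)%:C *: w1.
Proof.
case: gh => gg _ ghn.
have wg x : braket (rcomb h x) (g i) = 0.
  rewrite braket_suml big1 // => j _.
  by rewrite braketZl braketC ghn rmorph0 mulr0.
have -> : Eh h *m U *m g i =
    Eh h *m ((a i)%:C *: w + (a1 i)%:C *: w1 + (a2 i)%:C *: v2).
  rewrite -mulmxA; congr (_ *m _).
  by rewrite !mulmxDl !ketbra_ket !wg !scale0r !addr0 !braket_rcombl.
by rewrite 2!mulmxDr -!scalemxAr !Eh_rcombh Eh_rcombg scaler0 addr0.
Qed.

(** The first hypothesis is completeness of [w], [w1] in the span of [h], which lets each [h i] be
    expanded in them. Equal off-diagonal entries then leave a diagonal difference with nonnegative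
    entries. *)
Lemma swap_psdmx (x : 'I_3 -> R) (z : 'I_2 -> R) :
  (forall i j, b i * b j + b1 i * b1 j = (i == j)%:R) ->
  \sum_i x i * a i ^+ 2 <= \sum_i z i * b i ^+ 2 ->
  \sum_i x i * (a i * a1 i) = \sum_i z i * (b i * b1 i) ->
  \sum_i x i * a1 i ^+ 2 <= \sum_i z i * b1 i ^+ 2 ->
  psdmx (\sum_i (z i)%:C *: ketbra (h i) (h i)
         - \sum_i (x i)%:C *:
             (Eh h *m U *m ketbra (g i) (g i) *m U ^t* *m Eh h)).
Proof.
move=> bb le1 eq2 le3.
have hE i : h i = (b i)%:C *: w + (b1 i)%:C *: w1.
  rewrite !rcombZ rcombD /rcomb (bigD1 i) //= big1 => [|j ji].
    by rewrite bb eqxx scale1r addr0.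
  by rewrite bb eq_sym (negPf ji) scale0r.
have EhE : (Eh h) ^t* = Eh h by rewrite adjmxD !ketbra_adj.
have gE i : Eh h *m U *m ketbra (g i) (g i) *m U ^t* *m Eh h =
    ketbra ((a i)%:C *: w + (a1 i)%:C *: w1) ((a i)%:C *: w + (a1 i)%:C *: w1).
  rewrite -swap_block -mulmx_ketbra adjmxM EhE !mulmxA //.
under eq_bigr do rewrite hE.
under [X in _ - X]eq_bigr do rewrite gE.
rewrite !sum_ketbra_pair eq2.
set A := ketbra w w; set B := ketbra w1 w1; set C := _ *: (_ + _).
set za := \sum_i _ * b _ ^+ 2; set xa := \sum_i _ * a _ ^+ 2.
set zb := \sum_i _ * b1 _ ^+ 2; set xb := \sum_i _ * a1 _ ^+ 2.
have cancel (K : nzRingType) (V : lmodType K) (p q r s : K) (X Y Z : V) :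
    p *: X + Z + q *: Y - (r *: X + Z + s *: Y) = (p - r) *: X + (q - s) *: Y.
  rewrite opprD addrACA -scalerBl; congr (_ + _).
  by rewrite opprD addrACA subrr addr0 -scalerBl.
rewrite cancel -!rmorphB.
by apply: psdmxD; apply: psdmx_ketbra; rewrite subr_ge0.
Qed.

End Blocks.
End SwapUnitary.

(** * The angle equation *)

Section Angle.
Local Set Implicit Arguments.
Local Unset Strict Implicit.
Context {R : realType}.
Implicit Types a b c t x y : R.

(** [acos] only reaches angles with nonnegative sine; a negative [y] is obtained by negating the
    angle. *)
Lemma unit_circle_angle x y :
  x ^+ 2 + y ^+ 2 = 1 -> exists t : R, cos t = x /\ sin t = y.
Proof.
move=> xy1.
have x1 : x ^+ 2 <= 1 by rewrite -xy1 lerDl sqr_ge0.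
have xI : -1 <= x <= 1.
  by rewrite -ler_norml -(@ler_sqr _ `|x|) ?nnegrE // real_normK ?num_real ?expr1n.
have sE : sin (acos x) = `|y|.
  by rewrite sin_acos // -xy1 addrAC subrr add0r sqrtr_sqr.
have cE : cos (acos x) = x by rewrite acosK // in_itv.
have [y0|y0] := leP 0 y.
  by exists (acos x); rewrite cE sE ger0_norm.
by exists (- acos x); rewrite cosN sinN cE sE ltr0_norm // opprK.
Qed.

(* The solutions are the two points where a line meets the unit circle, at
   distance [s / r] from the foot of the perpendicular through the origin. *)
Lemma angle_closest a b c (r := b ^+ 2 + c ^+ 2) (s := Num.sqrt (r - a ^+ 2)) :
  0 < r -> a ^+ 2 <= r ->
  exists t : R, cos t * b + sin t * c = a /\
    forall t', cos t' * b + sin t' * c = a -> `|cos t - 1| <= `|cos t' - 1|.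
Proof.
move=> r0 ar.
have s2 : s ^+ 2 = b ^+ 2 + c ^+ 2 - a ^+ 2 by rewrite sqr_sqrtr ?subr_ge0.
have rn0 : b ^+ 2 + c ^+ 2 != 0 by rewrite gt_eqF.
(* The point used is the foot [(a / r) (b, c)] moved by [e / r] along the perpendicular direction
   [(- c, b)]. *)
have sol e : e ^+ 2 = s ^+ 2 ->
    exists2 t, cos t * b + sin t * c = a & cos t = (a * b - c * e) / r.
  move=> e2.
  have [|t [ct st]] := @unit_circle_angle ((a * b - c * e) / r) ((a * c + b * e) / r).
    have -> : ((a * b - c * e) / r) ^+ 2 + ((a * c + b * e) / r) ^+ 2 =
        (a ^+ 2 + e ^+ 2) / r by rewrite /r; field.
    by rewrite e2 s2 addrC subrK divff.
  by exists t => //; rewrite ct st /r; field.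
have [t1 t1E c1] := sol s erefl.
have [t2 t2E c2] := sol (- s) (sqrrN s).
(* Here [e] is the component of (cos t, sin t) along [(- c, b)], up to scaling;
   [a ^+ 2 + e ^+ 2 = r] forces [e = s] or [e = - s]. Only two cosines remain to compare. *)
have only t : cos t * b + sin t * c = a -> cos t = cos t1 \/ cos t = cos t2.
  move=> tE; pose e := sin t * b - cos t * c.
  have cE : cos t = (a * b - c * e) / r.
    rewrite -tE /e /r.
    have -> : (cos t * b + sin t * c) * b - c * (sin t * b - cos t * c) =
      cos t * (b ^+ 2 + c ^+ 2) by ring.
    by rewrite mulfK.
  have e2 : e ^+ 2 = s ^+ 2.
    rewrite s2 -tE /e -[b ^+ 2 + c ^+ 2]mul1r -(cos2Dsin2 t); ring.
  rewrite c1 c2 cE.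
  by move/eqP: e2; rewrite eqf_sqr => /orP[/eqP ->|/eqP ->]; [left|right].
have [le12|/ltW le21] := leP `|cos t1 - 1| `|cos t2 - 1|.
  by exists t1; split=> // t /only[] ->.
by exists t2; split=> // t /only[] ->.
Qed.

End Angle.

(** * Coordinate tuples for kets on two or three basis vectors *)

Section Move.
Local Set Implicit Arguments.
Local Unset Strict Implicit.
Context {R : realType}.

Lemma sum_ord2 (V : nmodType) (F : 'I_2 -> V) : \sum_i F i = F 0 + F 1.
Proof.
by rewrite !big_ord_recl big_ord0 addr0; congr (F _ + F _); exact: val_inj.
Qed.

Lemma sum_ord3 (V : nmodType) (F : 'I_3 -> V) : \sum_i F i = F 0 + F 1 + F 2.
Proof.
rewrite !big_ord_recl big_ord0 addr0 addrA.
by congr (F _ + F _ + F _); exact: val_inj.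
Qed.

Definition tup3 (x y z : R) : 'I_3 -> R := fun i => [:: x; y; z]`_i.
Definition tup2 (x y : R) : 'I_2 -> R := fun i => [:: x; y]`_i.

Lemma rcomb_tup3 n (e : 'I_3 -> 'cV[R[i]]_n) x y z :
  rcomb e (tup3 x y z) = x%:C *: e 0 + y%:C *: e 1 + z%:C *: e 2.
Proof. exact: sum_ord3. Qed.

Lemma rcomb_tup2 n (e : 'I_2 -> 'cV[R[i]]_n) x y :
  rcomb e (tup2 x y) = x%:C *: e 0 + y%:C *: e 1.
Proof. exact: sum_ord2. Qed.

Lemma dotr_tup3 x y z x' y' z' :
  dotr (tup3 x y z) (tup3 x' y' z') = x * x' + y * y' + z * z'.
Proof. exact: sum_ord3. Qed.

Lemma dotr_tup2 x y x' y' : dotr (tup2 x y) (tup2 x' y') = x * x' + y * y'.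
Proof. exact: sum_ord2. Qed.

Lemma scale_tup3 k x y z : (fun i => k * tup3 x y z i) = tup3 (k * x) (k * y) (k * z).
Proof. by apply/funext => -[[|[|[|//]]] ?]. Qed.

Lemma scale_tup2 k x y : (fun i => k * tup2 x y i) = tup2 (k * x) (k * y).
Proof. by apply/funext => -[[|[|//]] ?]. Qed.

Lemma add_tup3 x y z x' y' z' :
  (fun i => tup3 x y z i + tup3 x' y' z' i) = tup3 (x + x') (y + y') (z + z').
Proof. by apply/funext => -[[|[|[|//]]] ?]. Qed.

End Move.

(** * Moves from three points to two *)

(** The left-hand side is the quadratic form with diagonal [G], [S] and off-diagonal entry [r] at a
    unit vector. Since [2 * c * s] has modulus at most 1, the cross term costs at most [e]. *)
Lemma rotated_form_le {R : realType} (c s G S r e : R) :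
  c ^+ 2 + s ^+ 2 = 1 -> S <= G -> 0 <= e -> r ^+ 2 <= e ^+ 2 ->
  c ^+ 2 * G + 2 * (c * s * r) + s ^+ 2 * S <= G + e.
Proof.
move=> cs SG e0 re.
have rle : `|r| <= e by rewrite -(@ler_sqr _ `|r|) ?nnegrE // real_normK ?num_real.
have /andP[er re'] : (- e <= r <= e) by rewrite -ler_norml.
have h1 : 0 <= s ^+ 2 * (G - S) by rewrite mulr_ge0 ?sqr_ge0 ?subr_ge0.
have h2 : 0 <= (e + r) * (c - s) ^+ 2.
  by rewrite mulr_ge0 ?sqr_ge0 // -[r]opprK subr_ge0 lerNl.
have h3 : 0 <= (e - r) * (c + s) ^+ 2 by rewrite mulr_ge0 ?sqr_ge0 ?subr_ge0.
rewrite -subr_ge0.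
have -> : G + e - (c ^+ 2 * G + 2 * (c * s * r) + s ^+ 2 * S) =
    s ^+ 2 * (G - S) + ((e + r) * (c - s) ^+ 2 + (e - r) * (c + s) ^+ 2) / 2.
  transitivity ((c ^+ 2 + s ^+ 2) * (G + e) -
      (c ^+ 2 * G + 2 * (c * s * r) + s ^+ 2 * S)); first by rewrite cs mul1r.
  by field.
by rewrite addr_ge0 // divr_ge0 // addr_ge0.
Qed.

Section MoveVectors.
Local Set Implicit Arguments.
Local Unset Strict Implicit.
Context {R : realType}.
Variables (m : move32 R) (g : 'I_3 -> 'cV[R[i]]_5) (h : 'I_2 -> 'cV[R[i]]_5).
Hypotheses (gh : orthonormal_kets g h).
Hypotheses (pg_gt0 : forall i, 0 < pg m i) (ph_gt0 : forall i, 0 < ph m i).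

(** Square roots are kept as positive atoms and the weights are rewritten as their squares, so that
    identities between coordinates become rational and [field] applies. *)
Let a0 := Num.sqrt (pg m 0).
Let a1 := Num.sqrt (pg m 1).
Let a2 := Num.sqrt (pg m 2).
Let b0 := Num.sqrt (ph m 0).
Let b1 := Num.sqrt (ph m 1).
Let N := Num.sqrt (pg m 0 + pg m 1 + pg m 2).
Let K := Num.sqrt (pg m 1 + pg m 2).
Let H := Num.sqrt (ph m 0 + ph m 1).

Let a0_gt0 : 0 < a0. Proof. by rewrite sqrtr_gt0. Qed.
Let a1_gt0 : 0 < a1. Proof. by rewrite sqrtr_gt0. Qed.
Let a2_gt0 : 0 < a2. Proof. by rewrite sqrtr_gt0. Qed.
Let b0_gt0 : 0 < b0. Proof. by rewrite sqrtr_gt0. Qed.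
Let b1_gt0 : 0 < b1. Proof. by rewrite sqrtr_gt0. Qed.
Let N_gt0 : 0 < N. Proof. by rewrite sqrtr_gt0 !addr_gt0. Qed.
Let K_gt0 : 0 < K. Proof. by rewrite sqrtr_gt0 !addr_gt0. Qed.
Let H_gt0 : 0 < H. Proof. by rewrite sqrtr_gt0 !addr_gt0. Qed.

Let a0_sqr : pg m 0 = a0 ^+ 2. Proof. by rewrite sqr_sqrtr ?ltW. Qed.
Let a1_sqr : pg m 1 = a1 ^+ 2. Proof. by rewrite sqr_sqrtr ?ltW. Qed.
Let a2_sqr : pg m 2 = a2 ^+ 2. Proof. by rewrite sqr_sqrtr ?ltW. Qed.
Let b0_sqr : ph m 0 = b0 ^+ 2. Proof. by rewrite sqr_sqrtr ?ltW. Qed.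
Let b1_sqr : ph m 1 = b1 ^+ 2. Proof. by rewrite sqr_sqrtr ?ltW. Qed.
Let N_sqr : N ^+ 2 = a0 ^+ 2 + a1 ^+ 2 + a2 ^+ 2.
Proof. by rewrite sqr_sqrtr -?a0_sqr -?a1_sqr -?a2_sqr // !addr_ge0 ?ltW. Qed.
Let K_sqr : K ^+ 2 = a1 ^+ 2 + a2 ^+ 2.
Proof. by rewrite sqr_sqrtr -?a1_sqr -?a2_sqr // !addr_ge0 ?ltW. Qed.
Let H_sqr : H ^+ 2 = b0 ^+ 2 + b1 ^+ 2.
Proof. by rewrite sqr_sqrtr -?b0_sqr -?b1_sqr // !addr_ge0 ?ltW. Qed.

Let sqrt_sqr (x y : R) : 0 < x -> y = x ^+ 2 -> Num.sqrt y = x.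
Proof. by move=> x0 ->; rewrite sqrtr_sqr gtr0_norm. Qed.

Let v_rawE : v_raw m g = rcomb g (tup3 a0 a1 a2).
Proof. by rewrite rcomb_tup3 /v_raw sum_ord3. Qed.

Let v1_rawE : v1_raw m g = rcomb g (tup3 0 a2 (- a1)).
Proof. by rewrite rcomb_tup3 scale0r add0r rmorphN scaleNr. Qed.

Let v2_rawE : v2_raw m g = rcomb g (tup3 (- (K ^+ 2 / a0)) a1 a2).
Proof. by rewrite rcomb_tup3 /v2_raw K_sqr -a1_sqr -a2_sqr. Qed.

Let w_rawE : w_raw m h = rcomb h (tup2 b0 b1).
Proof. by rewrite rcomb_tup2 /w_raw sum_ord2. Qed.

Let w1_rawE : w1_raw m h = rcomb h (tup2 b1 (- b0)).
Proof. by rewrite rcomb_tup2 rmorphN scaleNr. Qed.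

Lemma NgE : Ng m g = Num.sqrt (pg m 0 + pg m 1 + pg m 2).
Proof.
case: gh => gg _ _; rewrite /Ng v_rawE ketnorm_rcomb // sum_ord3.
by rewrite a0_sqr a1_sqr a2_sqr.
Qed.

Lemma Nv1E : Nv1 m g = Num.sqrt (pg m 1 + pg m 2).
Proof.
case: gh => gg _ _; rewrite /Nv1 v1_rawE ketnorm_rcomb // sum_ord3.
by rewrite a1_sqr a2_sqr; congr Num.sqrt; rewrite /tup3 /=; ring.
Qed.

(** The squared norm is [K ^+ 4 / a0 ^+ 2 + K ^+ 2], and [K ^+ 2 + a0 ^+ 2 = N ^+ 2]. *)
Lemma Nv2E : Nv2 m g = K * N / a0.
Proof.
case: gh => gg _ _; rewrite /Nv2 v2_rawE ketnorm_rcomb // sum_ord3.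
have a0n0 : a0 != 0 by rewrite gt_eqF.
apply: sqrt_sqr; first by rewrite divr_gt0 ?mulr_gt0.
rewrite /tup3 /= -addrA -K_sqr.
have -> : (K * N / a0) ^+ 2 = K ^+ 2 * N ^+ 2 / a0 ^+ 2 by field.
by rewrite N_sqr -addrA -K_sqr; field.
Qed.

Lemma NhE : Nh m h = Num.sqrt (ph m 0 + ph m 1).
Proof.
case: gh => _ hh _; rewrite /Nh w_rawE ketnorm_rcomb // sum_ord2.
by rewrite b0_sqr b1_sqr.
Qed.

(* Coordinates in the bases [g] and [h] of v, v1, v2, w, w1, with [K] = N_v1 and
   N_v2 = [K * N / a0]. *)
Let cv := tup3 (a0 / N) (a1 / N) (a2 / N).
Let cv1 := tup3 0 (a2 / K) (- (a1 / K)).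
Let cv2 := tup3 (- (K / N)) (a0 * a1 / (K * N)) (a0 * a2 / (K * N)).
Let cw := tup2 (b0 / H) (b1 / H).
Let cw1 := tup2 (b1 / H) (- (b0 / H)).

Lemma vketE : vket m g = rcomb g cv.
Proof. by rewrite /vket v_rawE NgE rcombZ scale_tup3 !(mulrC N^-1). Qed.

Lemma v1ketE : v1ket m g = rcomb g cv1.
Proof.
by rewrite /v1ket v1_rawE Nv1E rcombZ scale_tup3 mulr0 mulrN !(mulrC K^-1).
Qed.

Lemma v2ketE : v2ket m g = rcomb g cv2.
Proof.
have [a0n0 Kn0 Nn0] : [/\ a0 != 0, K != 0 & N != 0] by rewrite !gt_eqF.
rewrite /v2ket v2_rawE Nv2E rcombZ scale_tup3 /cv2; congr (rcomb _ (tup3 _ _ _)).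
all: by field; rewrite a0n0 Kn0 Nn0.
Qed.

Lemma wketE : wket m h = rcomb h cw.
Proof. by rewrite /wket w_rawE NhE rcombZ scale_tup2 !(mulrC H^-1). Qed.

Lemma w1ketE : w1ket m h = rcomb h cw1.
Proof. by rewrite /w1ket w1_rawE NhE rcombZ scale_tup2 mulrN !(mulrC H^-1). Qed.

Let cv1' t := tup3 (- (sin t * (K / N)))
  (cos t * (a2 / K) + sin t * (a0 * a1 / (K * N)))
  (- (cos t * (a1 / K)) + sin t * (a0 * a2 / (K * N))).
Let cv2' t := tup3 (cos t * (K / N))
  (sin t * (a2 / K) - cos t * (a0 * a1 / (K * N)))
  (- (sin t * (a1 / K)) - cos t * (a0 * a2 / (K * N))).

Lemma v1ket'E t : v1ket' m g t = rcomb g (cv1' t).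
Proof.
rewrite /v1ket' v1ketE v2ketE !rcombZ !scale_tup3 rcombD add_tup3.
by congr (rcomb _ (tup3 _ _ _)); ring.
Qed.

Lemma v2ket'E t : v2ket' m g t = rcomb g (cv2' t).
Proof.
rewrite /v2ket' -scaleNr -rmorphN v1ketE v2ketE !rcombZ !scale_tup3 rcombD add_tup3.
by congr (rcomb _ (tup3 _ _ _)); ring.
Qed.

Let H2n0 : b0 ^+ 2 + b1 ^+ 2 != 0.
Proof. by rewrite -H_sqr expf_neq0 // gt_eqF. Qed.

Let cw_norm : dotr cw cw = 1 /\ dotr cw1 cw1 = 1.
Proof.
have Hn0 : H != 0 by rewrite gt_eqF.
rewrite !dotr_tup2.
have -> : b0 / H * (b0 / H) + b1 / H * (b1 / H) = (b0 ^+ 2 + b1 ^+ 2) / H ^+ 2 by field.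
have -> : b1 / H * (b1 / H) + - (b0 / H) * - (b0 / H) = (b0 ^+ 2 + b1 ^+ 2) / H ^+ 2.
  by field.
by rewrite H_sqr divff.
Qed.

Let cw_orth : dotr cw cw1 = 0.
Proof. by rewrite dotr_tup2; ring. Qed.

Let cw_complete i j : cw i * cw j + cw1 i * cw1 j = (i == j)%:R.
Proof.
have Hn0 : H != 0 by rewrite gt_eqF.
have e1 : b0 / H * (b0 / H) + b1 / H * (b1 / H) = 1.
  by case: cw_norm; rewrite !dotr_tup2.
by move: i j => [[|[|//]] ?] [[|[|//]] ?]; rewrite -val_eqE /cw /cw1 /tup2 /= -?e1 ;
  ring.
Qed.

Let KN_sqr : N ^+ 2 = a0 ^+ 2 + K ^+ 2.
Proof. by rewrite N_sqr K_sqr addrA. Qed.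

(** The triple [cv], [cv1], [cv2] is orthonormal, and the primed pair arises from [cv1], [cv2] by an
    orthogonal reflection; bilinearity reduces all products to the unprimed ones. *)
Let cv_basis t :
  [/\ dotr cv cv = 1, dotr (cv1' t) (cv1' t) = 1 & dotr (cv2' t) (cv2' t) = 1] /\
  [/\ dotr cv (cv1' t) = 0, dotr cv (cv2' t) = 0 & dotr (cv1' t) (cv2' t) = 0].
Proof.
have [a0n0 Kn0 Nn0] : [/\ a0 != 0, K != 0 & N != 0] by rewrite !gt_eqF.
have N2n0 : a0 ^+ 2 + K ^+ 2 != 0 by rewrite -KN_sqr expf_neq0.
have eK : a1 ^+ 2 = K ^+ 2 - a2 ^+ 2 by rewrite K_sqr addrK.
have eN : a0 ^+ 2 = N ^+ 2 - K ^+ 2 by rewrite KN_sqr addrK.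
have e01 : dotr cv cv1 = 0 by rewrite dotr_tup3; field; rewrite Kn0 Nn0.
have e00 : dotr cv cv = 1.
  rewrite dotr_tup3.
  have -> : a0 / N * (a0 / N) + a1 / N * (a1 / N) + a2 / N * (a2 / N) =
    (a0 ^+ 2 + a1 ^+ 2 + a2 ^+ 2) / N ^+ 2 by field.
  by rewrite -N_sqr divff // expf_neq0.
have e11 : dotr cv1 cv1 = 1.
  rewrite dotr_tup3.
  have -> : 0 * 0 + a2 / K * (a2 / K) + - (a1 / K) * - (a1 / K) =
    (a1 ^+ 2 + a2 ^+ 2) / K ^+ 2 by field.
  by rewrite -K_sqr divff // expf_neq0.
have e02 : dotr cv cv2 = 0.
  rewrite dotr_tup3.
  have -> : a0 / N * - (K / N) + a1 / N * (a0 * a1 / (K * N))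
     + a2 / N * (a0 * a2 / (K * N)) =
    a0 / (K * N ^+ 2) * (a1 ^+ 2 + a2 ^+ 2 - K ^+ 2) by field; rewrite Kn0 Nn0.
  by rewrite K_sqr subrr mulr0.
have e12 : dotr cv1 cv2 = 0 by rewrite dotr_tup3; field; rewrite Kn0 Nn0.
have e22 : dotr cv2 cv2 = 1.
  rewrite dotr_tup3.
  have -> : - (K / N) * - (K / N) + a0 * a1 / (K * N) * (a0 * a1 / (K * N))
     + a0 * a2 / (K * N) * (a0 * a2 / (K * N)) =
    (K ^+ 2 + a0 ^+ 2 * ((a1 ^+ 2 + a2 ^+ 2) / K ^+ 2)) / N ^+ 2.
    by field; rewrite Kn0 Nn0.
  by rewrite -K_sqr divff ?expf_neq0 // mulr1 addrC -KN_sqr divff // expf_neq0.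
have bil1 p x : dotr x (fun i => p.1 * cv1 i + p.2 * cv2 i) =
    p.1 * dotr x cv1 + p.2 * dotr x cv2.
  by rewrite /dotr !sum_ord3; ring.
have bil2 p x : dotr (fun i => p.1 * cv1 i + p.2 * cv2 i) x =
    p.1 * dotr cv1 x + p.2 * dotr cv2 x.
  by rewrite /dotr !sum_ord3; ring.
have e21 : dotr cv2 cv1 = 0.
  by rewrite -e12; apply: eq_bigr => i _; rewrite mulrC.
have cs := cos2Dsin2 t.
have E1 : cv1' t = (fun i => (cos t, sin t).1 * cv1 i + (cos t, sin t).2 * cv2 i).
  by apply/funext => -[[|[|[|//]]] ?]; rewrite /cv1' /cv1 /cv2 /tup3 /=; ring.
have E2 : cv2' t = (fun i => (sin t, - cos t).1 * cv1 i + (sin t, - cos t).2 * cv2 i).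
  by apply/funext => -[[|[|[|//]]] ?]; rewrite /cv2' /cv1 /cv2 /tup3 /=; ring.
rewrite E1 E2 !bil2 !bil1 /= e00 e01 e02 e11 e12 e21 e22.
by split; split=> //; rewrite ?mulr0 ?mulr1 ?addr0 ?add0r ?oppr0 //;
  first [ring | rewrite -cs; ring].
Qed.

Lemma move_unitary t : Umx m g h t \is unitarymx /\ Umx m g h t *m vket m g = wket m h.
Proof.
have [vn vo] := cv_basis t.
rewrite /Umx vketE v1ket'E v2ket'E wketE w1ketE; split.
  by apply: swap_unitarymx.
by apply: swap_ket.
Qed.

(** * Solvability and positivity for a mass-preserving move *)

Hypotheses (xg0 : xg m 0 = 0).
Let n := pg m 0 + pg m 1 + pg m 2.
Let k := pg m 1 + pg m 2.
Let xs := pg m 1 * xg m 1 + pg m 2 * xg m 2.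
Hypotheses (mass : n = ph m 0 + ph m 1).

(** With [H = N] and [xg m 0 = 0], these are the matrix elements <w|X_h|w1>, <v|X_g|v1> and
    <v|X_g|v2>. *)
Let A := b0 * b1 / N ^+ 2 * (xh m 0 - xh m 1).
Let B := a1 * a2 / (N * K) * (xg m 1 - xg m 2).
Let C := a0 / (K * N ^+ 2) * xs.

Let HN : H = N.
Proof. by rewrite /H -mass. Qed.

Lemma angle_eqE t : angle_eq m g h t <-> cos t * B + sin t * C = A.
Proof.
have [a0n0 Kn0 Nn0] : [/\ a0 != 0, K != 0 & N != 0] by rewrite !gt_eqF.
rewrite /angle_eq /mean_xg NhE NgE Nv1E Nv2E -/H -/N -/K HN sum_ord3 xg0.
rewrite mulr0 add0r -/xs !sqrtrM ?ltW // -/b0 -/b1 -/a1 -/a2.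
have -> : b0 * b1 / N ^+ 2 * (xh m 0 - xh m 1)
    - cos t * (a1 * a2 / (N * K)) * (xg m 1 - xg m 2)
    - sin t * ((N ^+ 2)^-1 * xs) * (N / (K * N / a0)) =
    A - (cos t * B + sin t * C).
  by rewrite /A /B /C; field; rewrite a0n0 Kn0 Nn0.
by split=> [/eqP|<-]; [rewrite subr_eq0 => /eqP|rewrite subrr].
Qed.

(** Clearing the denominator [(K * N ^+ 2) ^+ 2] in [A ^+ 2 <= B ^+ 2 + C ^+ 2] gives the stated
    inequality. Positivity of [xs] makes [C] positive, so the line has a nonzero normal. *)
Lemma move_angle :
  0 < xs ->
  ph m 0 * ph m 1 * (xh m 0 - xh m 1) ^+ 2 * k <=
    pg m 1 * pg m 2 * (xg m 1 - xg m 2) ^+ 2 * n + pg m 0 * xs ^+ 2 ->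
  exists t, closest_angle m g h t.
Proof.
move=> xs0; have [a0n0 Kn0 Nn0] : [/\ a0 != 0, K != 0 & N != 0] by rewrite !gt_eqF.
have -> : k = K ^+ 2 by rewrite K_sqr -a1_sqr -a2_sqr.
have -> : n = N ^+ 2 by rewrite N_sqr -a0_sqr -a1_sqr -a2_sqr.
rewrite a0_sqr a1_sqr a2_sqr b0_sqr b1_sqr => le.
have C0 : 0 < C by rewrite mulr_gt0 // divr_gt0 // mulr_gt0 // exprn_gt0.
have [|| t [tE tmin]] := @angle_closest R A B C.
- by rewrite ltr_wpDl ?sqr_ge0 // exprn_gt0.
- have -> : A ^+ 2 =
      (b0 ^+ 2 * b1 ^+ 2 * (xh m 0 - xh m 1) ^+ 2 * K ^+ 2) / (K * N ^+ 2) ^+ 2.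
    by rewrite /A; field; rewrite Kn0 Nn0.
  have -> : B ^+ 2 + C ^+ 2 =
      (a1 ^+ 2 * a2 ^+ 2 * (xg m 1 - xg m 2) ^+ 2 * N ^+ 2 + a0 ^+ 2 * xs ^+ 2)
        / (K * N ^+ 2) ^+ 2.
    by rewrite /B /C; field; rewrite Kn0 Nn0.
  by rewrite ler_pM2r // invr_gt0 exprn_gt0 // mulr_gt0 // exprn_gt0.
by exists t; split=> [|t' /angle_eqE]; [apply/angle_eqE | exact: tmin].
Qed.

(** The three conditions of [swap_psdmx] come from the comparison of means, the angle equation, and
    [rotated_form_le] applied to X_g on the span of v1 and v2. *)
Lemma move_psdmx e t :
  xs <= ph m 0 * xh m 0 + ph m 1 * xh m 1 ->
  pg m 0 * xs / (k * n) <= (pg m 2 * xg m 1 + pg m 1 * xg m 2) / k ->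
  0 <= e ->
  (pg m 2 * xg m 1 + pg m 1 * xg m 2) / k + e <=
    (ph m 1 * xh m 0 + ph m 0 * xh m 1) / n ->
  pg m 0 * pg m 1 * pg m 2 * (xg m 1 - xg m 2) ^+ 2 <= e ^+ 2 * (k ^+ 2 * n) ->
  angle_eq m g h t ->
  psdmx (\sum_i (xh m i)%:C *: ketbra (h i) (h i)
         - \sum_i (xg m i)%:C *:
             (Eh h *m Umx m g h t *m ketbra (g i) (g i) *m (Umx m g h t) ^t* *m Eh h)).
Proof.
have [a0n0 Kn0 Nn0] : [/\ a0 != 0, K != 0 & N != 0] by rewrite !gt_eqF.
have -> : k = K ^+ 2 by rewrite K_sqr -a1_sqr -a2_sqr.
have -> : n = N ^+ 2 by rewrite N_sqr -a0_sqr -a1_sqr -a2_sqr.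
rewrite !a0_sqr !a1_sqr !a2_sqr !b0_sqr !b1_sqr.
move=> mean Sle e0 Hle rle /angle_eqE tE.
have [vn vo] := cv_basis t.
rewrite /Umx vketE v1ket'E v2ket'E wketE w1ketE.
apply: swap_psdmx => //; rewrite sum_ord3 sum_ord2 xg0 mul0r add0r;
  rewrite /cv /cv1' /cw /cw1 /tup3 /tup2 /= HN.
- have -> : xg m 1 * (a1 / N) ^+ 2 + xg m 2 * (a2 / N) ^+ 2 = xs / N ^+ 2.
    by rewrite /xs a1_sqr a2_sqr; field.
  have -> : xh m 0 * (b0 / N) ^+ 2 + xh m 1 * (b1 / N) ^+ 2 =
      (b0 ^+ 2 * xh m 0 + b1 ^+ 2 * xh m 1) / N ^+ 2 by field.
  by rewrite ler_pM2r // invr_gt0 exprn_gt0.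
- transitivity (cos t * B + sin t * C).
    by rewrite /B /C /xs a1_sqr a2_sqr; field; rewrite Kn0 Nn0.
  by rewrite tE /A; field.
- have -> : xh m 0 * (b1 / N) ^+ 2 + xh m 1 * (- (b0 / N)) ^+ 2 =
      (b1 ^+ 2 * xh m 0 + b0 ^+ 2 * xh m 1) / N ^+ 2 by field.
  apply: le_trans Hle.
  (* This is <v1|X_g|v2>. *)
  pose r := a0 * a1 * a2 * (xg m 1 - xg m 2) / (K ^+ 2 * N).
  have r2 : r ^+ 2 <= e ^+ 2.
    have -> : r ^+ 2 = a0 ^+ 2 * a1 ^+ 2 * a2 ^+ 2 * (xg m 1 - xg m 2) ^+ 2
        / ((K ^+ 2) ^+ 2 * N ^+ 2) by rewrite /r; field; rewrite Kn0 Nn0.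
    by rewrite ler_pdivrMr // mulr_gt0 // !exprn_gt0.
  apply: le_trans (rotated_form_le _ _ _ _ _ _ (cos2Dsin2 t) Sle e0 r2).
  rewrite le_eqVlt; apply/orP; left; apply/eqP.
  by rewrite /r /xs a1_sqr a2_sqr; field; rewrite Kn0 Nn0.
Qed.

End MoveVectors.

(** * The bias move for small parameters *)

(* [mc_row] is <v2|X_g|v2> <= <v1|X_g|v1>, [mc_gap] is <v1|X_g|v1> + e <= <w1|X_h|w1>,
   [mc_off] is |<v1|X_g|v2>| <= e, and [mc_angle] is the solvability of the angle
   equation. *)
Record move_conditions {R : realType} (m : move32 R) (e : R) : Prop := MoveConditions {
  mc_pg : forall i, 0 < pg m i;
  mc_ph : forall i, 0 < ph m i;
  mc_xg0 : xg m 0 = 0;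
  mc_mass : pg m 0 + pg m 1 + pg m 2 = ph m 0 + ph m 1;
  mc_mean_gt0 : 0 < pg m 1 * xg m 1 + pg m 2 * xg m 2;
  mc_mean : pg m 1 * xg m 1 + pg m 2 * xg m 2 <= ph m 0 * xh m 0 + ph m 1 * xh m 1;
  mc_angle : ph m 0 * ph m 1 * (xh m 0 - xh m 1) ^+ 2 * (pg m 1 + pg m 2) <=
    pg m 1 * pg m 2 * (xg m 1 - xg m 2) ^+ 2 * (pg m 0 + pg m 1 + pg m 2)
    + pg m 0 * (pg m 1 * xg m 1 + pg m 2 * xg m 2) ^+ 2;
  mc_row : pg m 0 * (pg m 1 * xg m 1 + pg m 2 * xg m 2)
      / ((pg m 1 + pg m 2) * (pg m 0 + pg m 1 + pg m 2)) <=
    (pg m 2 * xg m 1 + pg m 1 * xg m 2) / (pg m 1 + pg m 2);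
  mc_gap : (pg m 2 * xg m 1 + pg m 1 * xg m 2) / (pg m 1 + pg m 2) + e <=
    (ph m 1 * xh m 0 + ph m 0 * xh m 1) / (pg m 0 + pg m 1 + pg m 2);
  mc_off : pg m 0 * pg m 1 * pg m 2 * (xg m 1 - xg m 2) ^+ 2 <=
    e ^+ 2 * ((pg m 1 + pg m 2) ^+ 2 * (pg m 0 + pg m 1 + pg m 2))
}.

Section Weights.
Local Set Implicit Arguments.
Local Unset Strict Implicit.
Context {R : realType}.
Variables (G1 G2 y0 y : R).
Hypotheses (y0_gt0 : 0 < y0) (y0y : y0 < y).
Hypotheses (yG1 : y < G1) (yG2 : y < G2).

Definition weight t : R := - fpoly G1 G2 y0 t / t.

Local Notation wt := weight.
Let A := y0 * G1 * G2.
Let C := y0 + G1 + G2.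

Let y_gt0 : 0 < y. Proof. exact: lt_trans y0y. Qed.

Lemma weight_gt0 t : y0 < t -> t < G1 -> t < G2 -> 0 < weight t.
Proof.
move=> y0t tG1 tG2; have t0 : 0 < t by exact: lt_trans y0t.
by rewrite divr_gt0 // /fpoly -!mulNr opprB !mulr_gt0 // subr_gt0.
Qed.

(** Expanding the cubic, [weight t] is [t ^+ 2 - C * t - A / t] plus a constant, with [A] the
    product and [C] the sum of the roots. *)
Lemma weightB s t : s != 0 -> t != 0 ->
  weight s - weight t = (s - t) * (A / (s * t) - (C - s - t)).
Proof. by move=> s0 t0; rewrite /weight /fpoly /A /C; field; rewrite s0 t0. Qed.

(* The weights of [bias_move] are [e0 d * d ^+ 3], [wt (y - 2 * d)],
   [2 * wt (y + d)] and [2 * wt (y - d)], [wt (y + 2 * d)], all divided by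
   [12 * d ^+ 2]. *)
Let pi4 (d : R) : R := (y + 2 * d) * (y + d) * (y - d) * (y - 2 * d).
Let e0 (d : R) : R := 12 * fpoly G1 G2 y0 0 / pi4 d.
Let n (d : R) : R := 2 * wt (y - d) + wt (y + 2 * d).
Let k (d : R) : R := wt (y - 2 * d) + 2 * wt (y + d).
Let X (d : R) : R := wt (y - 2 * d) * (y - 2 * d) + 2 * wt (y + d) * (y + d).
(** [L1] and [L2] are divided differences of [weight] over the symmetric pairs at distance [d] and
    [2 * d] from [y]; at 0 both give the derivative at [y]. *)
Let L1 (d : R) : R := A / ((y - d) * (y + d)) - (C - (y - d) - (y + d)).
Let L2 (d : R) : R := A / ((y + 2 * d) * (y - 2 * d)) - (C - (y + 2 * d) - (y - 2 * d)).

(* Up to a positive factor, each [Q] is the difference of the two sides of one of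
   the inequalities of [move_conditions]; it is continuous and positive at 0. *)
Let Qangle (d : R) : R := e0 d * X d ^+ 2 + 36 * (wt (y + 2 * d) * wt (y - 2 * d) * L1 d)
  - 144 * (wt (y - d) * wt (y + d) * L2 d).
Let Qrow (d : R) : R := (2 * wt (y + d) * (y - 2 * d) + wt (y - 2 * d) * (y + d)) * n d
  - e0 d * d ^+ 3 * X d.
Let Qgap (d : R) : R := (4 * wt (y - d) - wt (y + 2 * d)) * k d
  - (wt (y - 2 * d) - 4 * wt (y + d)) * n d - k d * n d.
Let Qoff (d : R) : R := k d ^+ 2 * n d
  - 18 * (e0 d * d ^+ 3 * wt (y - 2 * d) * wt (y + d)).

(* Restated so that [apply:] finds the summands by higher-order pattern unification. *)
Let cvgD' (f1 f2 : R -> R) (a b : R) : f1 x @[x --> 0] --> a -> f2 x @[x --> 0] --> b ->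
  f1 x + f2 x @[x --> 0] --> a + b.
Proof. exact: cvgD. Qed.
Let cvgN' (f1 : R -> R) (a : R) : f1 x @[x --> 0] --> a -> - f1 x @[x --> 0] --> - a.
Proof. exact: cvgN. Qed.
Let cvgM' (f1 f2 : R -> R) (a b : R) : f1 x @[x --> 0] --> a -> f2 x @[x --> 0] --> b ->
  f1 x * f2 x @[x --> 0] --> a * b.
Proof. exact: cvgM. Qed.
Let cvgX' (f1 : R -> R) j (a : R) : f1 x @[x --> 0] --> a ->
  f1 x ^+ j @[x --> 0] --> a ^+ j.
Proof.
move=> f1a; elim: j => [|j IH]; first exact: cvg_cst.
by under eq_fun do rewrite exprS; rewrite exprS; exact: cvgM'.
Qed.
Let cvgV' (f1 : R -> R) (a : R) : a != 0 -> f1 x @[x --> 0] --> a ->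
  (f1 x)^-1 @[x --> 0] --> a^-1.
Proof. by move=> a0; exact: cvgV. Qed.

Let cvg_weight' (f1 : R -> R) (a : R) : a != 0 -> f1 x @[x --> 0] --> a ->
  wt (f1 x) @[x --> 0] --> wt a.
Proof.
move=> a0 f1a; rewrite /weight /fpoly.
apply: cvgM'; last exact: cvgV'.
apply: cvgN'; apply: cvgM'; first apply: cvgM'.
all: by apply: cvgD'; [exact: cvg_cst | exact: cvgN'].
Qed.

(** The limit is the function's own expression with 0 substituted, so recursion on its shape
    suffices; what remains is the nonvanishing of denominators and of arguments of [wt]. *)
Ltac cvg_tac := repeat lazymatch goal with
  | |- context [_ --> GRing.add _ _] => apply: cvgD'
  | |- context [_ --> GRing.opp _] => apply: cvgN'
  | |- context [_ --> GRing.mul _ _] => apply: cvgM'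
  | |- context [_ --> GRing.exp _ _] => apply: cvgX'
  | |- context [_ --> GRing.inv _] => apply: cvgV'
  | |- context [_ --> wt _] => apply: cvg_weight'
  | |- context [_ --> _] => first [exact: cvg_cst | exact: cvg_id]
  end.

Let near_gt0 (q : R -> R) : q x @[x --> 0] --> q 0 -> 0 < q 0 ->
  \forall d \near 0^'+, 0 < q d.
Proof. by move=> /cvg_at_right_filter qc q0; exact: cvgr_gt q0. Qed.

(** * Values at zero and positivity for small parameters *)

Let yn0 : y != 0. Proof. by rewrite gt_eqF. Qed.

Let simp0 := (mulr0, subr0, addr0).

Let wt0 : 0 < wt y. Proof. exact: weight_gt0. Qed.

Let e00 : e0 0 = 12 * A / y ^+ 4.
Proof.
rewrite /e0 /pi4 /A /fpoly !simp0.
by congr (_ / _); ring.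
Qed.

Lemma near_order :
  \forall d \near 0^'+, [/\ 0 < d, y0 < y - 2 * d, y + 2 * d < G1 & y + 2 * d < G2].
Proof.
have n1 : \forall d \near 0^'+, 0 < y - 2 * d - y0.
  by apply: near_gt0; [cvg_tac | rewrite !simp0 subr_gt0].
have n2 : \forall d \near 0^'+, 0 < G1 - (y + 2 * d).
  by apply: near_gt0; [cvg_tac | rewrite !simp0 subr_gt0].
have n3 : \forall d \near 0^'+, 0 < G2 - (y + 2 * d).
  by apply: near_gt0; [cvg_tac | rewrite !simp0 subr_gt0].
near=> d; split; rewrite -?[_ < y - _]subr_gt0 -?[_ < G1]subr_gt0 -?[_ < G2]subr_gt0.
- by near: d; exact: nbhs_right_gt.
- by near: d.
- by near: d.
- by near: d.
Unshelve. all: by end_near. Qed.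

Lemma near_angle : \forall d \near 0^'+, 0 < Qangle d.
Proof.
have Qangle_cvg : Qangle x @[x --> 0] --> Qangle 0.
  by rewrite /Qangle /e0 /X /L1 /L2 /pi4 /fpoly; cvg_tac; rewrite ?simp0 ?mulf_neq0.
apply: near_gt0 Qangle_cvg _.
rewrite /Qangle e00 /X /L1 /L2 !simp0.
(* The coefficients 36 and -144 leave -108 times the derivative [A / y ^+ 2 - (C - y - y)]; its [A]
   part cancels against the term from [e0]. *)
have -> : 12 * A / y ^+ 4 * (wt y * y + 2 * wt y * y) ^+ 2
   + 36 * (wt y * wt y * (A / (y * y) - (C - y - y)))
   - 144 * (wt y * wt y * (A / (y * y) - (C - y - y))) =
   108 * wt y ^+ 2 * (C - y - y) by field.
have C0 : 0 < C - y - y.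
  have -> : C - y - y = y0 + (G1 - y) + (G2 - y) by rewrite /C; ring.
  by rewrite addr_gt0 ?subr_gt0 // addr_gt0 ?subr_gt0.
by apply: mulr_gt0 => //; apply: mulr_gt0; [rewrite ltr0n | exact: exprn_gt0].
Qed.

Lemma near_row : \forall d \near 0^'+, 0 < Qrow d.
Proof.
have Qrow_cvg : Qrow x @[x --> 0] --> Qrow 0.
  by rewrite /Qrow /e0 /X /n /pi4 /fpoly; cvg_tac; rewrite ?simp0 ?mulf_neq0.
apply: near_gt0 Qrow_cvg _.
rewrite /Qrow /n expr0n /= !simp0 mul0r subr0.
have -> : (2 * wt y * y + wt y * y) * (2 * wt y + wt y) = 9 * (y * wt y ^+ 2) by ring.
by apply: mulr_gt0; [rewrite ltr0n | apply: mulr_gt0 => //; exact: exprn_gt0].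
Qed.

(** To first order the gap is [2 * d], against [e = d]: the terms of [Qgap 0] are 9 + 9 - 9 times
    [wt y ^+ 2]. *)
Lemma near_gap : \forall d \near 0^'+, 0 < Qgap d.
Proof.
apply: near_gt0.
  by rewrite /Qgap /n /k; cvg_tac; rewrite ?simp0.
rewrite /Qgap /n /k !simp0.
have -> : (4 * wt y - wt y) * (wt y + 2 * wt y) -
    (wt y - 4 * wt y) * (2 * wt y + wt y) -
    (wt y + 2 * wt y) * (2 * wt y + wt y) = 9 * wt y ^+ 2 by ring.
by apply: mulr_gt0; [rewrite ltr0n | exact: exprn_gt0].
Qed.

Lemma near_off : \forall d \near 0^'+, 0 < Qoff d.
Proof.
have Qoff_cvg : Qoff x @[x --> 0] --> Qoff 0.
  by rewrite /Qoff /e0 /n /k /pi4 /fpoly; cvg_tac; rewrite ?simp0 ?mulf_neq0.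
apply: near_gt0 Qoff_cvg _.
rewrite /Qoff /n /k expr0n /= !simp0 !mul0r !simp0.
have -> : (wt y + 2 * wt y) ^+ 2 * (2 * wt y + wt y) = 27 * wt y ^+ 3 by ring.
by apply: mulr_gt0; [rewrite ltr0n | exact: exprn_gt0].
Qed.

(** * From exact identities of the weights to the move conditions *)

Lemma bias_moveE d (m := bias_move G1 G2 y0 y d) : d != 0 ->
  [/\ [/\ pg m 0 = e0 d * d ^+ 3 / (12 * d ^+ 2), pg m 1 = wt (y - 2 * d) / (12 * d ^+ 2)
        & pg m 2 = 2 * wt (y + d) / (12 * d ^+ 2)],
      ph m 0 = 2 * wt (y - d) / (12 * d ^+ 2) /\ ph m 1 = wt (y + 2 * d) / (12 * d ^+ 2),
      [/\ xg m 0 = 0, xg m 1 = y - 2 * d & xg m 2 = y + d]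
    & xh m 0 = y - d /\ xh m 1 = y + 2 * d].
Proof.
move=> d0.
have N1 : (-1)%:~R * d = - d by rewrite mulN1r.
have N2 : (-2)%:~R * d = - (2 * d) by rewrite -mulNr.
have P1 : 1%:~R = 1 :> R by [].
have P2 : 2%:~R = 2 :> R by [].
have dn12 : 12 * d ^+ 2 != 0 by rewrite mulf_neq0 ?expf_neq0 // pnatr_eq0.
have div12 a t : a / (12 * d ^+ 2 * t) = a / t / (12 * d ^+ 2).
  by rewrite invfM mulrA mulrAC.
have div6 a t : a / (6 * d ^+ 2 * t) = 2 * (a / t) / (12 * d ^+ 2).
  by rewrite invfM; move: t^-1 => i; field.
rewrite /m /bias_move /= N1 N2 P1 P2 !mul1r.
split; split=> //; rewrite ?div12 ?div6 //.
rewrite /e0 /pi4; move: (fpoly _ _ _ 0) (_^-1) => q i.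
by field.
Qed.

(** The choice [e = d] lies between the cross term, of order d^(5/2), and the gap, about [2 * d]. *)
Lemma bias_conditions d :
  [/\ 0 < d, y0 < y - 2 * d, y + 2 * d < G1 & y + 2 * d < G2] ->
  0 < Qangle d -> 0 < Qrow d -> 0 < Qgap d -> 0 < Qoff d ->
  move_conditions (bias_move G1 G2 y0 y d) d.
Proof.
move=> [d0 dy dG1 dG2] Qa Qr Qg Qo.
have [yl [ya [yb yc]]] : 0 < y - 2 * d /\ 0 < y - d /\ 0 < y + d /\ 0 < y + 2 * d.
  by move: y0_gt0 => ?; do ?split; lra.
have [yln0 yan0 ybn0 ycn0] : [/\ y - 2 * d != 0, y - d != 0, y + d != 0 & y + 2 * d != 0].
  by rewrite !gt_eqF.
have fl0 : 0 < wt (y - 2 * d) by apply: weight_gt0 => //; lra.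
have fa0 : 0 < wt (y - d) by apply: weight_gt0; lra.
have fb0 : 0 < wt (y + d) by apply: weight_gt0; lra.
have fc0 : 0 < wt (y + 2 * d) by apply: weight_gt0 => //; lra.
have e0_gt0 : 0 < e0 d.
  apply: divr_gt0; last by rewrite !mulr_gt0.
  apply: mulr_gt0; first by rewrite ltr0n.
  by rewrite /fpoly !subr0 !mulr_gt0 // (lt_trans y_gt0).
(* Up to scaling, the signed weights are the coefficients of the divided difference of f at the five
   points. A fourth-order divided difference of a cubic is zero. *)
have massE : e0 d * d ^+ 3 + k d = n d.
  rewrite /e0 /pi4 /k /n /weight /fpoly; field.
  by rewrite yln0 yan0 ybn0 ycn0.
(* The same divided difference applied to t f(t), a quartic with leading coefficient -1, gives the
   surplus [12 * d ^+ 3]. *)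
have meanE : X d + 12 * d ^+ 3 = 2 * wt (y - d) * (y - d) + wt (y + 2 * d) * (y + 2 * d).
  rewrite /X /weight /fpoly; field.
  by rewrite yln0 yan0 ybn0 ycn0.
have diff1 : wt (y + d) = wt (y - d) + 2 * d * L1 d.
  rewrite -[LHS](subrK (wt (y - d))) weightB // addrC /L1; congr (_ + _); field.
  by rewrite yan0 ybn0.
have diff2 : wt (y + 2 * d) = wt (y - 2 * d) + 4 * d * L2 d.
  rewrite -[LHS](subrK (wt (y - 2 * d))) weightB // addrC /L2; congr (_ + _); field.
  by rewrite yln0 ycn0.
have [[g0 g1 g2] [h0 h1] [x0 x1 x2] [z0 z1]] := bias_moveE (lt0r_neq0 d0).
set m := bias_move _ _ _ _ _ in g0 g1 g2 h0 h1 x0 x1 x2 z0 z1 *.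
(* The common factor is made opaque so that [ring] and [field] treat it as an atom. *)
have sE : exists2 s, s = (12 * d ^+ 2)^-1 & 0 < s.
  by exists (12 * d ^+ 2)^-1 => //; rewrite invr_gt0 mulr_gt0 ?ltr0n ?exprn_gt0.
case: sE => s sE s0; rewrite -sE in g0 g1 g2 h0 h1.
have kE : pg m 1 + pg m 2 = k d * s by rewrite g1 g2 -mulrDl.
have nE : pg m 0 + pg m 1 + pg m 2 = n d * s by rewrite -addrA kE g0 -massE [RHS]mulrDl.
have XE : pg m 1 * xg m 1 + pg m 2 * xg m 2 = X d * s.
  by rewrite g1 g2 x1 x2 /X; ring.
have rowE : pg m 2 * xg m 1 + pg m 1 * xg m 2 =
    (2 * wt (y + d) * (y - 2 * d) + wt (y - 2 * d) * (y + d)) * s.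
  by rewrite g1 g2 x1 x2; ring.
have two0 : 0 < 2 :> R by rewrite ltr0n.
have k0 : 0 < k d by rewrite addr_gt0 // mulr_gt0.
have n0 : 0 < n d by rewrite addr_gt0 // mulr_gt0.
have X0 : 0 < X d by rewrite addr_gt0 // mulr_gt0 // mulr_gt0.
have [sn0 kn0 nn0] : [/\ s != 0, k d != 0 & n d != 0] by rewrite !gt_eqF.
have d3 : 0 < d ^+ 3 by exact: exprn_gt0.
have d2 : 0 < d ^+ 2 by exact: exprn_gt0.
have s3 : 0 < s ^+ 3 by exact: exprn_gt0.
split.
- have p0 : 0 < pg m 0 by rewrite g0; exact: mulr_gt0 (mulr_gt0 e0_gt0 d3) s0.
  have p1 : 0 < pg m 1 by rewrite g1; exact: mulr_gt0 fl0 s0.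
  have p2 : 0 < pg m 2 by rewrite g2; exact: mulr_gt0 (mulr_gt0 two0 fb0) s0.
  by move=> [[|[|[|//]]] lti3]; [move: p0|move: p1|move: p2];
    congr (0 < pg m _); exact: val_inj.
- have p0 : 0 < ph m 0 by rewrite h0; exact: mulr_gt0 (mulr_gt0 two0 fa0) s0.
  have p1 : 0 < ph m 1 by rewrite h1; exact: mulr_gt0 fc0 s0.
  by move=> [[|[|//]] lti2]; [move: p0|move: p1];
    congr (0 < ph m _); exact: val_inj.
- exact: x0.
- by rewrite nE h0 h1 -mulrDl.
- by rewrite XE mulr_gt0.
- rewrite XE h0 h1 z0 z1 [leRHS](_ : _ = (X d + 12 * d ^+ 3) * s).
    by rewrite ler_pM2r // lerDl mulr_ge0 ?ler0n // ltW.
  by rewrite meanE; ring.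
- rewrite kE nE XE g0 g1 g2 h0 h1 x1 x2 z0 z1 -subr_ge0.
  (* Apart from the [e0] term, the difference is a combination of [wt (y + d) - wt (y - d)] and
     [wt (y + 2 * d) - wt (y - 2 * d)] with a factor [d ^+ 2]; [diff1] and [diff2] supply the third
     power of [d]. *)
  rewrite [leRHS](_ : _ = d ^+ 3 * s ^+ 3 * Qangle d).
    by apply: ltW; rewrite mulr_gt0 // mulr_gt0.
  rewrite /Qangle /n /k; move: (X d) (e0 d) => X' e'.
  by rewrite diff1 diff2; ring.
- rewrite kE nE XE rowE g0.
  have -> : e0 d * d ^+ 3 * s * (X d * s) / (k d * s * (n d * s)) =
      e0 d * d ^+ 3 * X d / n d / k d by field; rewrite sn0 kn0 nn0.
  rewrite -mulf_div divff // mulr1 ler_pM2r ?invr_gt0 // ler_pdivrMr //.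
  by rewrite -subr_ge0 ltW.
- rewrite kE nE rowE h0 h1 z0 z1 -subr_ge0.
  rewrite [leRHS](_ : _ = d * Qgap d / (k d * n d)).
    by rewrite divr_ge0 ?mulr_ge0 // ltW.
  rewrite /Qgap.
  (* Both averages are centred at [y], which cancels in their difference and leaves a factor [d]. *)
  have e1 : 2 * wt (y + d) * (y - 2 * d) + wt (y - 2 * d) * (y + d) =
      y * k d + d * (wt (y - 2 * d) - 4 * wt (y + d)) by rewrite /k; ring.
  have e2 : wt (y + 2 * d) * s * (y - d) + 2 * wt (y - d) * s * (y + 2 * d) =
      (y * n d + d * (4 * wt (y - d) - wt (y + 2 * d))) * s by rewrite /n; ring.
  rewrite e1 e2; move: (k d) (n d) kn0 nn0 => k' n' kn0 nn0.
  by field; rewrite sn0 kn0 nn0.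
- rewrite kE nE g0 g1 g2 x1 x2 -subr_ge0.
  rewrite [leRHS](_ : _ = d ^+ 2 * s ^+ 3 * Qoff d).
    by apply: ltW; rewrite mulr_gt0 // mulr_gt0.
  rewrite /Qoff; ring.
Qed.

Lemma near_move_conditions :
  \forall d \near 0^'+, move_conditions (bias_move G1 G2 y0 y d) d.
Proof.
near=> d; apply: bias_conditions.
- by near: d; exact: near_order.
- by near: d; exact: near_angle.
- by near: d; exact: near_row.
- by near: d; exact: near_gap.
- by near: d; exact: near_off.
Unshelve. all: by end_near. Qed.

End Weights.

Theorem mainTheorem3 (R : realType) (G1 G2 y0 y : R)
    (g : 'I_3 -> 'cV[R[i]]_5) (h : 'I_2 -> 'cV[R[i]]_5) :
  0 < y0 -> y0 < Num.min G1 G2 ->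
  y0 < y -> y < Num.min G1 G2 ->
  orthonormal_kets g h ->
  \forall d \near (0 : R)^'+,
    let m := bias_move G1 G2 y0 y d in
    [/\ exists t : R, angle_eq m g h t,
        exists t : R, closest_angle m g h t
      & forall t : R, closest_angle m g h t ->
        let U := Umx m g h t in
        [/\ U \is unitarymx,
            U *m vket m g = wket m h
          & psdmx (\sum_i (xh m i)%:C *: ketbra (h i) (h i)
                   - \sum_i (xg m i)%:C *:
                       (Eh h *m U *m ketbra (g i) (g i) *m U ^t* *m Eh h))]].
Proof.
move=> y0_gt0 _ y0y; rewrite lt_min => /andP[yG1 yG2] gh.
near=> d.
have d0 : 0 < d by near: d; exact: nbhs_right_gt.
have : move_conditions (bias_move G1 G2 y0 y d) d.
  by near: d; exact: near_move_conditions.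
set m := bias_move _ _ _ _ _ => -[pg0 ph0 xg0 mass mean0 mean ang row gap off].
have [t tP] := move_angle gh pg0 ph0 xg0 mass mean0 ang.
split; [by exists t; case: tP | by exists t | move=> {tP}t [tE _]].
have [Uu Uv] := move_unitary gh pg0 ph0 t.
split=> //.
exact: (move_psdmx gh pg0 ph0 xg0 mass mean row (ltW d0) gap off tE).
Unshelve. all: by end_near. Qed.
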